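(* Let $n\geq 3$ and $3\leq k\leq 2^{n-1}$ be integers. Then $$\kappa^s(Q_n;P_k)=\kappa(Q_n;P_k)=\begin{cases}\lceil \frac{2n}{k+1}\rceil & \text{if } k \text{ is odd},\\ \lceil \frac{2n}{k}\rceil & \text{if } k \text{ is even}.\end{cases}$$
   Context: $Q_n$ is the $n$-dimensional hypercube: its vertices are the binary strings of length $n$, two vertices being adjacent iff they differ in exactly one position. $P_k$ denotes the path with $k$ vertices (length $k-1$). For connected graphs $G,H$: an $H$-structure cut of $G$ is a set $F$ of subgraphs of $G$, each isomorphic to $H$, such that $G-V(F)$ (deleting all vertices of all members of $F$) is disconnected or trivial (a single vertex); an $H$-substructure cut is defined the same way except that each member of $F$ is isomorphic to a connected subgraph of $H$. The $H$-structure connectivity $\kappa(G;H)$ (resp. $H$-substructure connectivity $\kappa^s(G;H)$) is the minimum cardinality of an $H$-structure cut (resp. $H$-substructure cut) of $G$. *)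

(* Defs.v *)
From HB Require Import structures.
From mathcomp Require Import all_boot all_order all_algebra.

Set Implicit Arguments.
Unset Strict Implicit.
Unset Printing Implicit Defensive.

Record sgraph := SGraph {
  vertex :> finType;
  adj : rel vertex;
  adj_sym : symmetric adj;
  adj_irrefl : irreflexive adj
}.

Definition graph_iso (G H : sgraph) : Prop :=
  exists2 f : G -> H, bijective f & {mono f : x y / adj x y}.

Definition connected (G : sgraph) : Prop :=
  (exists x : G, true) /\ forall x y : G, connect (@adj G) x y.

Definition disconnected (G : sgraph) : Prop :=
  exists x y : G, ~~ connect (@adj G) x y.

Definition trivial (G : sgraph) : Prop := #|G| = 1.

(* A subgraph of G is given by a vertex set and a set of edges, an edge being *)
(* the set of its two ends; it need not be induced.                           *)
Definition subgraph_axiom (G : sgraph) (A : {set G} * {set {set G}}) : bool :=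
  [forall e in A.2, exists x in A.1, exists y in A.1,
     adj x y && (e == [set x; y])].

Record subgraph (G : sgraph) := Subgraph {
  subgraph_val :> {set G} * {set {set G}};
  subgraphP : subgraph_axiom subgraph_val
}.

HB.instance Definition _ (G : sgraph) := [isSub for @subgraph_val G].
HB.instance Definition _ (G : sgraph) := [Finite of subgraph G by <:].

Definition verts (G : sgraph) (A : subgraph G) : {set G} := (val A).1.
Definition edges (G : sgraph) (A : subgraph G) : {set {set G}} := (val A).2.

Section SubgraphGraph.
Variables (G : sgraph) (A : subgraph G).

Definition subgraph_adj : rel {x : G | x \in verts A} :=
  fun x y => [set val x; val y] \in edges A.

Lemma subgraph_adj_sym : symmetric subgraph_adj.
Proof. by move=> x y; rewrite /subgraph_adj setUC. Qed.

Lemma subgraph_adj_irrefl : irreflexive subgraph_adj.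
Proof.
move=> x; rewrite /subgraph_adj; apply/negP => xA.
have /forall_inP/(_ _ xA) := subgraphP A.
case/exists_inP => u _ /exists_inP[v _ /andP[uv /eqP E]].
have: u \in [set val x; val x] by rewrite E set21.
have: v \in [set val x; val x] by rewrite E set22.
rewrite !inE !orbb => /eqP vx /eqP ux.
by move: uv; rewrite ux vx adj_irrefl.
Qed.

Definition graph_of_subgraph : sgraph :=
  SGraph subgraph_adj_sym subgraph_adj_irrefl.

End SubgraphGraph.

Section Delete.
Variables (G : sgraph) (D : {set G}).

Definition delete_adj : rel {x : G | x \notin D} :=
  fun x y => adj (val x) (val y).

Lemma delete_adj_sym : symmetric delete_adj.
Proof. by move=> x y; rewrite /delete_adj adj_sym. Qed.

Lemma delete_adj_irrefl : irreflexive delete_adj.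
Proof. by move=> x; rewrite /delete_adj adj_irrefl. Qed.

Definition delete : sgraph := SGraph delete_adj_sym delete_adj_irrefl.

End Delete.

Definition family_verts (G : sgraph) (F : {set subgraph G}) : {set G} :=
  \bigcup_(A in F) verts A.

Definition separating (G : sgraph) (F : {set subgraph G}) : Prop :=
  disconnected (delete (family_verts F)) \/ trivial (delete (family_verts F)).

Definition structure_cut (G H : sgraph) (F : {set subgraph G}) : Prop :=
  (forall A, A \in F -> graph_iso (graph_of_subgraph A) H) /\ separating F.

Definition substructure_cut (G H : sgraph) (F : {set subgraph G}) : Prop :=
  (forall A, A \in F ->
     exists2 B : subgraph H, connected (graph_of_subgraph B) &
       graph_iso (graph_of_subgraph A) (graph_of_subgraph B))
  /\ separating F.

Definition min_card (T : finType) (P : {set T} -> Prop) (m : nat) : Prop :=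
  (exists2 F, P F & #|F| = m) /\ forall F, P F -> m <= #|F|.

(* The connectivities are relations "kappa(G;H) = m", so that the existence   *)
(* of a cut is part of the assertion and no default value is needed.          *)
Definition structure_connectivity (G H : sgraph) (m : nat) : Prop :=
  min_card (@structure_cut G H) m.

Definition substructure_connectivity (G H : sgraph) (m : nat) : Prop :=
  min_card (@substructure_cut G H) m.

Section Hypercube.
Variable n : nat.

Definition cube_adj : rel (n.-tuple bool) :=
  fun x y => #|[set i : 'I_n | tnth x i != tnth y i]| == 1.

Lemma cube_adj_sym : symmetric cube_adj.
Proof.
move=> x y; rewrite /cube_adj; congr (_ == _); apply: eq_card => i.
by rewrite !inE eq_sym.
Qed.

Lemma cube_adj_irrefl : irreflexive cube_adj.
Proof.
move=> x; rewrite /cube_adj (_ : [set i | _] = set0) ?cards0 //.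
by apply/setP => i; rewrite !inE eqxx.
Qed.

Definition hypercube : sgraph := SGraph cube_adj_sym cube_adj_irrefl.

End Hypercube.

Section Path.
Variable k : nat.

Definition path_adj : rel 'I_k := fun i j => (i.+1 == j) || (j.+1 == i).

Lemma path_adj_sym : symmetric path_adj.
Proof. by move=> i j; rewrite /path_adj orbC. Qed.

Lemma path_adj_irrefl : irreflexive path_adj.
Proof. by move=> i; rewrite /path_adj orbb gtn_eqF. Qed.

Definition path_graph : sgraph := SGraph path_adj_sym path_adj_irrefl.

End Path.

(* The ceiling of m / d is a nonnegative integer; absz only casts it to nat.  *)
Definition ceil_div (m d : nat) : nat :=
  absz (Num.ceil (m%:R / d%:R : rat)%R).

(* Main.v *)
Require Import Defs.
From mathcomp Require Import all_boot all_order all_algebra zify.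

(* Put m = ceil(k/2).  Both cases of the formula say that the value is the    *)
(* least f with n <= f * m.                                                   *)
(* Upper bound: the path e_1, e_1+e_2, e_2, ..., e_(n-1), e_(n-1)+e_n, e_n,   *)
(* continued by a Gray code of the half cube x_n = 1, avoids the origin and   *)
(* is long enough; its first k vertices contain the first min(m, n)           *)
(* neighbours of the origin.  Rotating the coordinates by multiples of m      *)
(* gives a family of paths isolating the origin.                              *)
(* Lower bound: let S be the vertex set of a family F of subpaths with        *)
(* #|F| * m < n.  Then #|S| <= 2n - 2, and no vertex outside S is isolated,   *)
(* because an independent set meets a path on at most k vertices in at most m *)
(* vertices.  Split the cube along a direction d.  If the component of v      *)
(* outside S never leaves the half of v, then for each direction j one of     *)
(* v+e_j, v+e_j+e_d lies in S; doing this for v and a neighbour of v yields   *)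
(* 2n - 2 distinct vertices of S.  So the complement of S is connected when   *)
(* #|S| <= 2n - 3.  If #|S| = 2n - 2, the members of F are disjoint and have  *)
(* k >= 3 vertices, so every component of S has at least 3 vertices, which    *)
(* excludes the extremal configurations.                                      *)

(** With [m = uphalf k], both ceilings are the least [f] such that [n <= f * m]. This is the cost of
    isolating a vertex: its [n] neighbours are pairwise nonadjacent, and a path on [k] vertices
    contains at most [m] of them ([card_independent]). [cover_path] attains this bound around the
    origin, and [structure_cut_upper] assembles the paths.

    For the lower bound, separating must be no cheaper than isolating. If [#|F| * m < n], the set
    [S] of faulty vertices has at most [2n - 2] elements. Some half of the cube has few faults and
    is connected; a vertex of the other half that cannot reach it is blocked, together with a
    fault-free neighbour, by [2n - 2] distinct faults. So [2n - 3] faults never suffice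
    ([no_isolated_connected]). With exactly [2n - 2], all components of [S] are large, which
    [tight_connected] refutes. A structure cut is a substructure cut, so one lower bound and one cut
    serve both invariants. *)

Set Implicit Arguments.
Unset Strict Implicit.
Unset Printing Implicit Defensive.

(** * Coordinate flips and parity *)

Section Flip.
Variable n : nat.
Implicit Types (x y v w : n.-tuple bool) (i j d : 'I_n).

Definition flip i x : n.-tuple bool := [tuple tnth x j (+) (j == i) | j < n].

Definition parity x := \big[addb/false]_(i < n) tnth x i.

Lemma tnth_flip i x j : tnth (flip i x) j = tnth x j (+) (j == i).
Proof. by rewrite tnth_mktuple. Qed.

Lemma flipK i : involutive (flip i).
Proof. by move=> x; apply: eq_from_tnth => j; rewrite !tnth_flip addbK. Qed.

Lemma flipC i j x : flip i (flip j x) = flip j (flip i x).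
Proof. by apply: eq_from_tnth => l; rewrite !tnth_flip addbAC. Qed.

Lemma flip_index_inj x : injective (flip^~ x).
Proof.
move=> i j /(congr1 (fun y => tnth y i)); rewrite !tnth_flip eqxx => /addbI.
by move/esym/eqP.
Qed.

Lemma parity_flip i x : parity (flip i x) = ~~ parity x.
Proof.
rewrite /parity (bigD1 i) //= [in RHS](bigD1 i) //= tnth_flip eqxx addbT addNb.
by congr (~~ (_ (+) _)); apply: eq_bigr => j /negPf ji; rewrite tnth_flip ji addbF.
Qed.

Lemma cube_adjP x y : reflect (exists i, y = flip i x) (cube_adj x y).
Proof.
apply: (iffP cards1P) => [[i xyi]|[i ->]]; exists i.
  apply: eq_from_tnth => j; rewrite tnth_flip.
  by have := in_set1 j i; rewrite -xyi inE => <-; case: (tnth x j) (tnth y j) => [] [].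
by apply/setP => j; rewrite !inE tnth_flip; case: (tnth x j) (j == i) => [] [].
Qed.

End Flip.

(** * Subcubes, stuck vertices and their obstacles *)

Section Cube.
Variables (n : nat) (S : {set n.-tuple bool}).
Implicit Types (x y v w : n.-tuple bool) (i j d : 'I_n) (D : {set 'I_n}).

(** Lower-dimensional cubes stay inside one tuple type, so induction on the dimension becomes
    induction on the set [D] of free directions. *)
Definition cube D x : {set n.-tuple bool} :=
  [set y | [forall i, (i \notin D) ==> (tnth y i == tnth x i)]].

Definition step D : rel (n.-tuple bool) :=
  fun x y => [&& x \notin S, y \notin S & [exists i in D, y == flip i x]].

Definition nonisolated D x := [exists i in D, flip i x \notin S].

Lemma cubeP D x y :
  reflect (forall i, i \notin D -> tnth y i = tnth x i) (y \in cube D x).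
Proof.
rewrite inE; apply: (iffP forallP) => xy i; first by move=> iD; apply/eqP/(implyP (xy i)).
by apply/implyP => /xy/eqP.
Qed.

Lemma cube_refl D x : x \in cube D x.
Proof. exact/cubeP. Qed.

Lemma cube_eq D x y : y \in cube D x -> cube D y = cube D x.
Proof.
move=> /cubeP xy; apply/setP => z.
by apply/cubeP/cubeP => h i iD; rewrite (h i iD) xy.
Qed.

Lemma cube_flip D x i : i \in D -> flip i x \in cube D x.
Proof.
move=> iD; apply/cubeP => j jD; rewrite tnth_flip.
by case: eqP jD => [->|]; rewrite ?iD ?addbF.
Qed.

Lemma cube_setT x : cube setT x = setT.
Proof. by apply/setP => y; rewrite in_setT; apply/cubeP => i; rewrite inE. Qed.

Lemma cube_set0 x : cube set0 x = [set x].
Proof.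
apply/setP => y; rewrite in_set1; apply/cubeP/eqP => [h|-> //].
by apply: eq_from_tnth => i; apply: h; rewrite inE.
Qed.

Lemma cubeD1 D x d : d \in D ->
  cube (D :\ d) x = [set y in cube D x | tnth y d == tnth x d].
Proof.
move=> dD; apply/setP => y; rewrite inE.
apply/cubeP/andP => [h|[/cubeP h /eqP hd] i].
  split; last by apply/eqP/h; rewrite !inE eqxx.
  by apply/cubeP => i iD; apply: h; rewrite !inE negb_and iD orbT.
by rewrite !inE negb_and negbK => /orP[/eqP -> //|]; apply: h.
Qed.

Lemma step_sym D : symmetric (step D).
Proof.
move=> x y; rewrite /step andbCA; do 2!congr (_ && _).
by apply/exists_inP/exists_inP => -[i iD /eqP ->]; exists i; rewrite ?flipK.
Qed.

Lemma connect_step_sym D : connect_sym (step D).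
Proof. exact/sym_connect_sym/step_sym. Qed.

Lemma connect_step_sub D1 D2 x y :
  D1 \subset D2 -> connect (step D1) x y -> connect (step D2) x y.
Proof.
move=> /subsetP D12; apply: connect_sub => u v /and3P[uS vS /exists_inP[i iD uv]].
by apply/connect1/and3P; split=> //; apply/exists_inP; exists i; rewrite // D12.
Qed.

Lemma connect_flip D x i : i \in D -> x \notin S -> flip i x \notin S ->
  connect (step D) x (flip i x).
Proof.
by move=> iD xS fS; apply/connect1/and3P; split=> //; apply/exists_inP; exists i.
Qed.

(* The component of v outside S, using directions in D, stays in the half    *)
(* x_d = v_d.                                                                 *)
Definition stuck D d v :=
  v \notin S /\ forall p, connect (step D) v p -> tnth p d = tnth v d.

(* A vertex of S on the walk v, v+e_j, v+e_j+e_d, when v is stuck.            *)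
Definition obstacle d v j :=
  if flip j v \in S then flip j v else flip d (flip j v).

(** Parity tells the two branches of [obstacle] apart: one makes a single flip, the other two. *)
Lemma obstacle_inj d v : injective (obstacle d v).
Proof.
move=> i j; rewrite /obstacle; case: ifP => _; case: ifP => _.
- exact: flip_index_inj.
- by move/(congr1 (@parity n)); rewrite !parity_flip; case: parity.
- by move/(congr1 (@parity n)); rewrite !parity_flip; case: parity.
- by move/(inv_inj (flipK d)); apply: flip_index_inj.
Qed.

Lemma obstacle_cube D d v j :
  d \in D -> j \in D -> obstacle d v j \in cube D v.
Proof.
move=> dD jD; rewrite /obstacle; case: ifP => _; first exact: cube_flip.
by rewrite -(cube_eq (cube_flip v jD)) cube_flip.
Qed.

Lemma tnth_obstacle d v j i :
  j != i -> d != i -> tnth (obstacle d v j) i = tnth v i.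
Proof.
rewrite /obstacle eq_sym [d == i]eq_sym => /negPf ji /negPf di.
by case: ifP => _; rewrite !tnth_flip ?ji ?di !addbF.
Qed.

Lemma stuck_flip D d v i : i \in D -> i != d ->
  stuck D d v -> flip i v \notin S -> stuck D d (flip i v).
Proof.
move=> iD /negPf id [vS vh] fS; split=> // p hp.
rewrite tnth_flip eq_sym id addbF; apply: vh.
by apply: connect_trans hp; apply: connect_flip.
Qed.

Lemma stuck_d D d v : d \in D -> stuck D d v -> flip d v \in S.
Proof.
move=> dD [vS vh]; case: (boolP (_ \in _)) => // fS.
have := vh _ (connect_flip dD vS fS).
by rewrite tnth_flip eqxx addbT => /eqP; case: (tnth v d).
Qed.

Lemma stuck_obstacle D d v j :
  d \in D -> j \in D -> stuck D d v -> obstacle d v j \in S.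
Proof.
move=> dD jD sv; rewrite /obstacle; case: ifPn => // jS.
have [jd|jd] := eqVneq j d; first by move: jS; rewrite jd (stuck_d dD sv).
exact: stuck_d dD (stuck_flip jD jd sv jS).
Qed.

End Cube.

(** * Connectivity of cubes with few faults *)

Section Connectivity.
Variables (n : nat) (S : {set n.-tuple bool}).
Implicit Types (x y v w : n.-tuple bool) (i j d : 'I_n) (D : {set 'I_n}).

Local Notation step := (step S).
Local Notation stuck := (stuck S).
Local Notation obstacle := (obstacle S).

Lemma stuck_or_escape D d v : v \notin S ->
  (exists2 p, connect (step D) v p & tnth p d = ~~ tnth v d) \/ stuck D d v.
Proof.
move=> vS.
have [/existsP[p /andP[vp pd]]|/existsPn h] :=
  boolP [exists p, connect (step D) v p && (tnth p d != tnth v d)].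
  by left; exists p => //; case: (tnth p d) (tnth v d) pd => [] [].
right; split=> // p vp; apply/eqP.
by have := h p; rewrite vp negbK.
Qed.

Lemma connect_step_cube D x y : x \notin S -> connect (step D) x y ->
  (y \in cube D x) && (y \notin S).
Proof.
move=> xS /connectP[p xp ->] {y}.
elim: p x xS xp => [|z p IHp] x xS /=; first by rewrite cube_refl.
case/andP => /and3P[_ zS /exists_inP[i iD /eqP xz]] zp.
by rewrite -(cube_eq (cube_flip x iD)) -xz IHp.
Qed.

Definition slice D x d b := [set y in cube D x | tnth y d == b].

Lemma sliceP D x d b y : reflect (y \in cube D x /\ tnth y d = b) (y \in slice D x d b).
Proof. by rewrite [_ \in slice _ _ _ _]in_set; apply: (iffP andP) => -[? /eqP]; split. Qed.

Lemma slice_cube D x d p : d \in D -> p \in cube D x ->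
  cube (D :\ d) p = slice D x d (tnth p d).
Proof. by move=> dD xp; rewrite cubeD1 // (cube_eq xp). Qed.

Lemma card_slice D x d :
  #|S :&: cube D x| = #|S :&: slice D x d true| + #|S :&: slice D x d false|.
Proof.
rewrite -(cardsID [set y | tnth y d]); congr (_ + _); apply: eq_card => y;
  rewrite !inE -?andbA.
  by rewrite eqb_id.
by rewrite eqbF_neg andbC -!andbA.
Qed.

(** The common engine: both ends escape into the half [b], where the escape points are joined. *)
Lemma connect_slices D d b x y :
    x \notin S -> y \notin S -> y \in cube D x ->
    (forall p q, p \in slice D x d b -> q \in slice D x d b ->
       p \notin S -> q \notin S -> connect (step D) p q) ->
    (forall v, v \in slice D x d (~~ b) -> ~ stuck D d v) ->
  connect (step D) x y.
Proof.
move=> xS yS xy Hb Hs.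
have reach v : v \in cube D x -> v \notin S ->
    exists2 p, connect (step D) v p & p \in slice D x d b.
  move=> xv vS; have [vb|vb] := eqVneq (tnth v d) b.
    by exists v => //; apply/sliceP.
  have {}vb : tnth v d = ~~ b by move: vb; case: (tnth v d); case: (b).
  have [[p vp pd]|sv] := stuck_or_escape D d vS; last by case: (Hs v) => //; apply/sliceP.
  exists p => //; apply/sliceP; split; last by rewrite pd vb negbK.
  by rewrite -(cube_eq xv); case/andP: (connect_step_cube vS vp).
have [p xp pb] := reach x (cube_refl D x) xS.
have [q yq qb] := reach y xy yS.
have /andP[_ pS] := connect_step_cube xS xp.
have /andP[_ qS] := connect_step_cube yS yq.
apply: connect_trans xp (connect_trans (Hb p q pb qb pS qS) _).
by rewrite connect_step_sym.
Qed.

Lemma obstacle_sub D d v (E : {set 'I_n}) :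
  d \in D -> E \subset D -> stuck D d v ->
  obstacle d v @: E \subset S :&: cube D v.
Proof.
move=> dD /subsetP ED sv; apply/subsetP => _ /imsetP[j /ED jD ->].
by rewrite inE (stuck_obstacle dD jD sv) obstacle_cube.
Qed.

Lemma card_obstacle d v (E : {set 'I_n}) : #|obstacle d v @: E| = #|E|.
Proof. exact/card_imset/obstacle_inj. Qed.

(** Obstacles of index other than [i] keep coordinate [i] of their base vertex, and the two base
    vertices differ there. *)
Lemma obstacle_pair_disjoint d v i : d != i ->
  [disjoint obstacle d v @: [set~ i] & obstacle d (flip i v) @: [set~ i]].
Proof.
move=> di; apply/pred0P => y /=; apply/negP => /andP[].
case/imsetP => j; rewrite !inE => ji -> /imsetP[l]; rewrite !inE => li.
move/(congr1 (fun y => tnth y i)); rewrite !tnth_obstacle // tnth_flip eqxx addbT.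
by case: (tnth v i).
Qed.

Lemma leq_obstacles D d v (E : {set 'I_n}) :
  d \in D -> E \subset D -> stuck D d v -> #|E| <= #|S :&: cube D v|.
Proof.
move=> dD ED sv; rewrite -(card_obstacle d v); apply: subset_leq_card.
exact: obstacle_sub.
Qed.

Lemma card_obstacle_pair d v i : d != i ->
  #|obstacle d v @: [set~ i] :|: obstacle d (flip i v) @: [set~ i]| = 2 * n.-1.
Proof.
move=> di; rewrite cardsU disjoint_setI0 ?obstacle_pair_disjoint // cards0.
by rewrite !card_obstacle cardsC1 card_ord subn0 addnn mul2n.
Qed.

Lemma leq_obstacle_pair D d v i : d \in D -> i \in D -> d != i ->
  stuck D d v -> stuck D d (flip i v) -> 2 * #|D :\ i| <= #|S :&: cube D v|.
Proof.
move=> dD iD di sv sw; rewrite mul2n -addnn.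
rewrite -{1}(card_obstacle d v) -(card_obstacle d (flip i v)).
have sD : D :\ i \subset [set~ i] by apply/subsetP => l; rewrite !inE => /andP[].
have dis : [disjoint obstacle d v @: (D :\ i) & obstacle d (flip i v) @: (D :\ i)].
  apply: disjointWl (imsetS _ sD) _; apply: disjointWr (imsetS _ sD) _.
  exact: obstacle_pair_disjoint.
rewrite -cardsUI (disjoint_setI0 dis) cards0 addn0; apply: subset_leq_card.
rewrite subUset obstacle_sub ?subsetDl // -(cube_eq (cube_flip v iD)).
by rewrite obstacle_sub ?subsetDl.
Qed.

(** One half is connected by induction, and a stuck vertex in the other would have [#|D|]
    obstacles. *)
Lemma few_faults_connected D x y :
  #|S :&: cube D x| <= #|D|.-1 -> x \notin S -> y \notin S -> y \in cube D x ->
  connect (step D) x y.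
Proof.
have [m] := ubnP #|D|; elim: m D x y => // m IHm D x y Dm Sm xS yS xy.
have [D0|[d dD]] := set_0Vmem D.
  by move: xy; rewrite D0 cube_set0 inE => /eqP ->.
have cD := cardsD1 d D; rewrite dD add1n in cD.
have cS := card_slice D x d.
have [b Sb] : exists b, #|S :&: slice D x d b| <= #|D :\ d|.-1.
  have [h|h] := leqP #|S :&: slice D x d true| #|D :\ d|.-1; first by exists true.
  by exists false; lia.
apply: (@connect_slices D d b) => // [p q pb qb pS qS|v /sliceP[xv vb] sv].
  apply: (@connect_step_sub _ _ (D :\ d)); first exact: subsetDl.
  case/sliceP: (pb) => xp pd.
  apply: IHm => //; rewrite ?(slice_cube dD xp) ?pd //; lia.
have := leq_obstacles dD (subxx D) sv; rewrite (cube_eq xv); lia.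
Qed.

Lemma slice_few_faults D x d b p q : d \in D ->
  #|S :&: slice D x d b| <= #|D|.-2 ->
  p \in slice D x d b -> q \in slice D x d b -> p \notin S -> q \notin S ->
  connect (step D) p q.
Proof.
move=> dD Sb /sliceP[xp pd] qb pS qS.
have cD := cardsD1 d D; rewrite dD add1n in cD.
apply: (@connect_step_sub _ _ (D :\ d)); first exact: subsetDl.
by apply: few_faults_connected => //; rewrite (slice_cube dD xp) pd //; move: Sb; rewrite cD.
Qed.

Lemma stuck_neighbour D d v : d \in D -> stuck D d v -> nonisolated S D v ->
  exists i, [/\ i \in D, d != i & stuck D d (flip i v)].
Proof.
move=> dD sv /exists_inP[i iD fS]; exists i.
have id : i != d by apply: contraNneq fS => ->; apply: stuck_d sv.
by split=> //; [rewrite eq_sym | apply: stuck_flip].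
Qed.

(** One half has at most [#|D| - 2] faults; a stuck vertex in the other has a stuck neighbour, and
    together they have [2 * #|D| - 2] distinct obstacles. *)
Lemma no_isolated_connected D x y : 2 <= #|D| ->
  #|S :&: cube D x| <= 2 * #|D| - 3 ->
  (forall z, z \in cube D x -> z \notin S -> nonisolated S D z) ->
  x \notin S -> y \notin S -> y \in cube D x -> connect (step D) x y.
Proof.
move=> D2 Sm iso xS yS xy.
have [D0|[d dD]] := set_0Vmem D; first by rewrite D0 cards0 in D2.
have cS := card_slice D x d.
have [b Sb] : exists b, #|S :&: slice D x d b| <= #|D|.-2.
  have [h|h] := leqP #|S :&: slice D x d true| #|D|.-2; first by exists true.
  by exists false; lia.
apply: (@connect_slices D d b) => // [p q|v /sliceP[xv vb] sv].
  exact: slice_few_faults.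
have [i [iD di sw]] := stuck_neighbour dD sv (iso v xv (proj1 sv)).
have cD := cardsD1 i D; rewrite iD add1n in cD.
have := leq_obstacle_pair dD iD di sv sw; rewrite (cube_eq xv) => h.
move: D2 (leq_trans h Sm); rewrite cD; set c := #|D :\ i|; lia.
Qed.

Lemma square_connected D x y : #|D| = 2 -> nonisolated S D x ->
  x \notin S -> y \notin S -> y \in cube D x -> connect (step D) x y.
Proof.
move=> D2 /exists_inP[i iD iS] xS yS xy.
have [j [jD ij Dij]] : exists j, [/\ j \in D, i != j & D = [set i; j]].
  have /cards1P[j Dj] : #|D :\ i| == 1 by move: (cardsD1 i D); rewrite iD D2; lia.
  have : j \in D :\ i by rewrite Dj inE.
  rewrite !inE eq_sym => /andP[ij jD]; exists j; split=> //.
  by rewrite -Dj setD1K.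
have ye z : tnth z i = tnth y i -> tnth z j = tnth y j ->
    (forall l, l \notin D -> tnth z l = tnth x l) -> y = z.
  move=> zi zj zl; apply: eq_from_tnth => l.
  have [lD|lD] := boolP (l \in D); last by rewrite zl // (cubeP _ _ _ xy).
  by move: lD; rewrite Dij !inE => /orP[]/eqP->.
have xi : connect (step D) x (flip i x) by apply: connect_flip.
have off l : l \notin D -> (l == i = false) * (l == j = false).
  by rewrite Dij !inE negb_or => /andP[/negPf-> /negPf->].
have [yi|yi] := eqVneq (tnth x i) (tnth y i);
  have [yj|yj] := eqVneq (tnth x j) (tnth y j).
- by rewrite (ye x).
- have e : y = flip j x.
    apply: ye => [||l lD]; rewrite tnth_flip ?(off l lD) ?eqxx ?(negPf ij) ?addbF //.
    by move: yj; case: (tnth x j); case: (tnth y j).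
  by rewrite e; apply: connect_flip; rewrite -?e.
- have e : y = flip i x.
    apply: ye => [||l lD]; rewrite tnth_flip ?(off l lD) ?eqxx 1?eq_sym ?(negPf ij) ?addbF //.
    by move: yi; case: (tnth x i); case: (tnth y i).
  by rewrite e.
have e : y = flip j (flip i x).
  apply: ye => [||l lD]; rewrite !tnth_flip ?(off l lD) ?eqxx ?(negPf ij) ?addbF //.
    by move: yi; case: (tnth x i); case: (tnth y i).
  rewrite eq_sym (negPf ij) addbF.
  by move: yj; case: (tnth x j); case: (tnth y j).
by apply: connect_trans xi _; rewrite e; apply: connect_flip; rewrite -?e.
Qed.

(** The bound [#|D| <= 2 * #|D| - 3] fails only in dimension 2, a 4-cycle treated by hand. *)
Lemma few_faults_no_isolated D x y : 2 <= #|D| -> #|S :&: cube D x| <= #|D| ->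
  (forall z, z \in cube D x -> z \notin S -> nonisolated S D z) ->
  x \notin S -> y \notin S -> y \in cube D x -> connect (step D) x y.
Proof.
move=> D2 Sm iso xS yS xy; have [D3|D3] := leqP 3 #|D|.
  apply: no_isolated_connected => //; lia.
apply: square_connected => //; first lia.
by apply: iso => //; apply: cube_refl.
Qed.

End Connectivity.

(** * The extremal case of [2n - 2] faults *)

Lemma exp2_ge n : 2 < n -> 4 * n - 4 <= 2 ^ n.
Proof.
elim: n => // m IH; rewrite ltnS leq_eqVlt => /orP[/eqP<- //|m3].
by have := IH m3; rewrite expnS; move: (2 ^ m) m3 => c; clear; lia.
Qed.

Section Tight.
Variables (n : nat) (S : {set n.-tuple bool}).
Implicit Types (x y v w : n.-tuple bool) (i j d : 'I_n).

Local Notation step := (step S).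
Local Notation stuck := (stuck S).
Local Notation obstacle := (obstacle S).

Definition closed_in (U : {set n.-tuple bool}) :=
  forall u p, u \in U -> flip p u \in S -> flip p u \in U.

(* Since U ranges over unions of components of S, this says that every        *)
(* component of S has at least 3 vertices.                                    *)
Definition big_components := forall U : {set n.-tuple bool},
  U \subset S -> U != set0 -> closed_in U -> 2 < #|U|.

(* When S consists of the obstacles of v and v+e_i only, an obstacle v+e_j    *)
(* has no neighbour in S other than v+e_i+e_j.                                *)
Lemma tight_adj d i v j p :
    S \subset obstacle d v @: [set~ i] :|: obstacle d (flip i v) @: [set~ i] ->
    d != i -> j != i -> j != d -> v \notin S ->
  flip j v \in S -> flip p (flip j v) \in S -> p = i.
Proof.
move=> /subsetP Sg di ji jd vS jS pS.
have := Sg _ pS; rewrite inE => /orP[]/imsetP[l]; rewrite !inE => li;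
  rewrite /obstacle; case: ifPn => lS e.
- by move/(congr1 (@parity n)): e; rewrite !parity_flip; case: parity.
- have lj : l != j by apply: contraNneq lS => ->.
  have /eqP pj : j == p.
    move/(congr1 (fun y => tnth y j)): e; rewrite !tnth_flip eqxx.
    by rewrite (negPf jd) [j == l]eq_sym (negPf lj); case: (tnth v j); case: (j == p).
  by move: pS; rewrite -pj flipK (negPf vS).
- move/(congr1 (fun y => tnth y i)): e; rewrite !tnth_flip eqxx.
  rewrite [i == j]eq_sym (negPf ji) [i == l]eq_sym (negPf li).
  by case: (tnth v i) (eqVneq i p) => -[].
- by move/(congr1 (@parity n)): e; rewrite !parity_flip; case: parity.
Qed.

Hypothesis n3 : 2 < n.
Hypothesis few : #|S| <= 2 * n - 2.
Hypothesis big : big_components.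
Hypothesis iso : forall x, x \notin S -> nonisolated S setT x.

(** Here [u] and its only possible neighbour in [S] would form a component with at most two
    vertices. *)
Lemma pendant_pair u i : u \in S ->
  (forall p, flip p u \in S -> p = i) ->
  (forall p, flip i u \in S -> flip p (flip i u) \in S -> p = i) -> False.
Proof.
move=> uS h1 h2.
pose U := S :&: [set u; flip i u].
suff : 2 < #|U|.
  have : #|U| <= #|[set u; flip i u]| by apply/subset_leq_card/subsetIr.
  by rewrite cards2; case: (u != _); move=> h1' h2'; have := leq_trans h2' h1'.
apply: big; rewrite ?subsetIl //.
  by apply/set0Pn; exists u; rewrite !inE uS eqxx.
move=> w p; rewrite !inE => /andP[wS /orP[]/eqP we] pS; rewrite pS /=.
  by move: pS; rewrite we => /h1 ->; rewrite eqxx orbT.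
by move: pS; rewrite we in wS * => /(h2 _ wS) ->; rewrite flipK eqxx.
Qed.

(** By counting, the obstacles of [v] and of a stuck neighbour [flip i v] exhaust [S]. Large
    components then force the [n - 1] obstacles of [v] with index other than [i] into the half [b],
    which is too many. *)
Lemma slice_few_not_stuck d b v :
  #|S :&: [set y | tnth y d == b]| <= n - 2 -> tnth v d = ~~ b -> ~ stuck setT d v.
Proof.
move=> Sb vb sv; have vS := proj1 sv.
have dT := in_setT d.
have [i [iT di sw]] := stuck_neighbour dT sv (iso vS).
have wS := proj1 sw.
pose O := obstacle d v @: [set~ i] :|: obstacle d (flip i v) @: [set~ i].
have OS : O \subset S.
  rewrite subUset; apply/andP; split; apply/subsetP => _ /imsetP[j _ ->];
  exact: stuck_obstacle (in_setT j) _.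
have {}OS : O = S.
  by apply/eqP; rewrite eqEcard OS card_obstacle_pair // (leq_trans few) //; lia.
have free j : j != i -> j != d -> flip j v \notin S.
  move=> ji jd; apply/negP => jS.
  apply: (@pendant_pair (flip j v) i jS) => [p|p iS].
    by apply: (tight_adj _ di ji jd vS jS); rewrite -/O OS.
  rewrite [flip i (flip j v)]flipC => pS.
  apply: (tight_adj _ di ji jd wS _ pS); last by rewrite flipC.
  by rewrite flipK setUC -/O OS.
have : #|obstacle d v @: [set~ i]| <= #|S :&: [set y | tnth y d == b]|.
  apply: subset_leq_card; apply/subsetP => y /imsetP[j ji ->]; rewrite !inE in ji *.
  rewrite (stuck_obstacle dT (in_setT j) sv) /obstacle.
  have [->|jd] := eqVneq j d.
    by rewrite (stuck_d dT sv) tnth_flip eqxx vb addbT negbK eqxx.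
  rewrite (negPf (free j ji jd)) !tnth_flip eqxx [d == j]eq_sym (negPf jd) vb.
  by rewrite addbF addbT negbK eqxx.
rewrite card_obstacle cardsC1 card_ord => h; move: (leq_trans h Sb); lia.
Qed.

(* Otherwise S meets this half in the neighbourhood of a vertex, and each of  *)
(* these vertices has no neighbour in S except its mirror image, which forms  *)
(* with it a component of size at most 2.                                     *)
Lemma balanced_slice_connected d b p q :
    #|S :&: [set y | tnth y d == b]| <= n.-1 ->
    #|S :&: [set y | tnth y d == ~~ b]| <= n.-1 ->
    tnth p d = b -> tnth q d = b -> p \notin S -> q \notin S ->
  connect (step (setT :\ d)) p q.
Proof.
move=> Sb Sb' pb qb pS qS.
have cT : #|[set: 'I_n] :\ d| = n.-1.
  have := cardsD1 d [set: 'I_n]; rewrite in_setT cardsT card_ord => e.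
  by rewrite (congr1 predn e).
have cube_slice x : tnth x d = b -> cube (setT :\ d) x = [set y | tnth y d == b].
  move=> xb; rewrite cubeD1 ?in_setT // cube_setT xb.
  by apply/setP => y; rewrite !inE.
have [/existsP[x /and3P[/eqP xb xS xi]]|/existsPn h] := boolP [exists x : n.-tuple bool,
    [&& tnth x d == b, x \notin S & ~~ nonisolated S (setT :\ d) x]]; last first.
  apply: few_faults_no_isolated; rewrite ?cT ?cube_slice //; first lia.
    move=> z; rewrite inE => zb zS.
    by have := h z; rewrite zb zS /= negbK.
  by rewrite inE qb.
have nbr j : j != d -> flip j x \in S.
  move=> jd; apply: contraNT xi => jS; apply/exists_inP; exists j => //.
  by rewrite !inE jd.
have Sx : S :&: [set y | tnth y d == b] = [set flip j x | j in [set~ d]].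
  apply/esym/eqP; rewrite eqEcard; apply/andP; split.
    apply/subsetP => y /imsetP[j jd ->]; rewrite !inE in jd *.
    by rewrite nbr // tnth_flip [d == j]eq_sym (negPf jd) addbF xb eqxx.
  by rewrite card_imset ?cardsC1 ?card_ord //; apply: flip_index_inj.
have par y : y \in S -> tnth y d = b -> parity y = ~~ parity x.
  move=> yS yb; have : y \in S :&: [set y | tnth y d == b] by rewrite !inE yS yb eqxx.
  by rewrite Sx => /imsetP[j _ ->]; rewrite parity_flip.
have indep y r : y \in S -> tnth y d = b -> flip r y \in S -> r = d.
  move=> yS yb rS; apply/eqP; apply: contraT => rd.
  have : parity (flip r y) = ~~ parity x.
    by apply: par; rewrite // tnth_flip [d == r]eq_sym (negPf rd) addbF.
  by rewrite parity_flip par // ; case: parity.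
have mate y : y \in S -> tnth y d = b -> flip d y \in S.
  move=> yS yb; apply: contraT => dS.
  case: (@pendant_pair y d yS) => [r|r dS']; first exact: indep.
  by rewrite dS' in dS.
(* The mirror images of these [n - 1] faults use up all the faults available in the other half. *)
have Sd : flip d @: (S :&: [set y | tnth y d == b]) = S :&: [set y | tnth y d == ~~ b].
  apply/eqP; rewrite eqEcard; apply/andP; split.
    apply/subsetP => z /imsetP[y + ->]; rewrite !inE => /andP[yS /eqP yb].
    by rewrite mate //= tnth_flip eqxx yb addbT eqxx.
  rewrite card_imset; last exact: inv_inj (flipK d).
  rewrite Sx card_imset ?cardsC1 ?card_ord //; exact: flip_index_inj.
have [j jd] : exists j, j != d.
  have /set0Pn[j] : [set~ d] != set0.
    by rewrite -card_gt0 cardsC1 card_ord; lia.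
  by rewrite !inE; exists j.
have jb : tnth (flip j x) d = b by rewrite tnth_flip [d == j]eq_sym (negPf jd) addbF.
case: (@pendant_pair (flip j x) d (nbr j jd)) => [r|r dS rS].
  exact: indep (nbr j jd) jb.
apply/eqP; apply: contraT => rd.
have : flip r (flip d (flip j x)) \in S :&: [set y | tnth y d == ~~ b].
  by rewrite inE rS inE !tnth_flip eqxx [d == r]eq_sym (negPf rd)
    [d == j]eq_sym (negPf jd) xb !addbF addbT eqxx.
rewrite -Sd => /imsetP[y]; rewrite !inE => /andP[yS /eqP yb].
move/(congr1 (@parity n)); rewrite !parity_flip (par y yS yb).
by case: parity.
Qed.

(* The splitting direction d is that of an edge inside S, so that if the two  *)
(* halves are connected and S separates them, #|S| > 2 ^ n.-1.                *)
Lemma tight_connected x y : x \notin S -> y \notin S -> connect (step setT) x y.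
Proof.
move=> xS yS; have cT : #|[set: 'I_n]| = n by rewrite cardsT card_ord.
have yx : y \in cube setT x by rewrite cube_setT in_setT.
have [S0|[s sS]] := set_0Vmem S.
  by apply: few_faults_connected => //; rewrite cube_setT setIT cT S0 cards0.
have [d dS] : exists d, flip d s \in S.
  apply/existsP; apply: contraT => /existsPn h.
  suff : 2 < #|[set s]| by rewrite cards1.
  apply: big; rewrite ?sub1set //; first by apply/set0Pn; exists s; rewrite inE.
  by move=> u p; rewrite inE => /eqP-> pS; have := h p; rewrite pS.
have hb b : slice setT x d b = [set y | tnth y d == b].
  by apply/setP => z; rewrite [LHS]in_set cube_setT !inE.
have cS := card_slice S setT x d.
rewrite cube_setT setIT !hb in cS.
have small b : #|S :&: [set y | tnth y d == b]| <= n - 2 -> connect (step setT) x y.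
  move=> Sb; apply: (@connect_slices _ _ _ d b) => // [p q|v]; last first.
    by rewrite hb inE => /eqP; apply: slice_few_not_stuck.
  by apply: slice_few_faults; rewrite ?in_setT // cT hb -subn2.
have [/small //|b1] := leqP #|S :&: [set y | tnth y d == true]| (n - 2).
have [/small //|b0] := leqP #|S :&: [set y | tnth y d == false]| (n - 2).
have bal b : #|S :&: [set y | tnth y d == b]| <= n.-1 by case: b; lia.
have conn p q : tnth p d = tnth q d -> p \notin S -> q \notin S ->
    connect (step setT) p q.
  move=> pq pS qS; apply: (@connect_step_sub _ _ (setT :\ d)); first exact: subsetDl.
  exact: (@balanced_slice_connected d (tnth q d)).
have [/existsP[u /andP[uS udS]]|/existsPn h] :=
  boolP [exists u : n.-tuple bool, (u \notin S) && (flip d u \notin S)].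
  have ud : connect (step setT) u (flip d u) by apply: connect_flip (in_setT d) uS udS.
  have reach p : p \notin S -> connect (step setT) p u.
    move=> pS; have [e|e] := eqVneq (tnth p d) (tnth u d); first exact: conn.
    apply: (@connect_trans _ _ (flip d u)); last by rewrite connect_step_sym.
    apply: conn => //; rewrite tnth_flip eqxx addbT.
    by move: e; case: (tnth p d); case: (tnth u d).
  by apply: connect_trans (reach x xS) _; rewrite connect_step_sym reach.
(* No fault-free edge crosses between the halves, so [S] and its mirror image cover the cube. *)
have : #|[set: n.-tuple bool]| <= #|S :|: flip d @: S|.
  apply: subset_leq_card; apply/subsetP => u _; rewrite inE.
  have := h u; rewrite negb_and !negbK => /orP[->//|fS].
  by apply/orP; right; rewrite -[u](flipK d) imset_f.
have : #|[set s; flip d s]| <= #|S :&: flip d @: S|.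
  apply: subset_leq_card; rewrite subUset !sub1set !inE sS dS imset_f //.
  by rewrite -{1}[s](flipK d) imset_f.
have := cardsUI S (flip d @: S).
rewrite card_imset; last exact: inv_inj (flipK d).
have -> : #|[set s; flip d s]| = 2.
  rewrite cards2; suff -> : s != flip d s by [].
  apply/eqP => /(congr1 (@parity n)); rewrite parity_flip; by case: parity.
rewrite cardsT card_tuple card_bool => h1 h2 h3.
have : 2 ^ n + 2 <= #|S| + #|S|.
  by rewrite -h1; apply: leq_add.
(* This is an equality at [n = 3]; the overlap [s], [flip d s] supplies the excess 2 that gives the
   contradiction. *)
have := exp2_ge n3.
move=> h4 h5; move: (leq_trans h5 (leq_add few few)) h4; move: (2 ^ n) => c; clear -n3; lia.
Qed.

End Tight.

(** * Subgraphs, and connected subgraphs of paths *)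

Section Graphs.
Implicit Types G H : sgraph.

Lemma set2_eq (T : finType) (a b c d : T) :
  [set a; b] = [set c; d] -> (a = c /\ b = d) \/ (a = d /\ b = c).
Proof.
move=> e.
have : a \in [set c; d] by rewrite -e set21.
have : b \in [set c; d] by rewrite -e set22.
have : c \in [set a; b] by rewrite e set21.
have : d \in [set a; b] by rewrite e set22.
by rewrite !inE => /orP[]/eqP ? /orP[]/eqP ? /orP[]/eqP ? /orP[]/eqP ?; subst; tauto.
Qed.

Lemma graph_iso_sym G H : graph_iso G H -> graph_iso H G.
Proof.
case=> f [g fK gK] fm; exists g; first by exists f.
by move=> x y; rewrite -fm !gK.
Qed.

Lemma graph_iso_trans G H K : graph_iso G H -> graph_iso H K -> graph_iso G K.
Proof.
case=> f fb fm [g gb gm]; exists (g \o f); first exact: bij_comp.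
by move=> x y; rewrite /= gm fm.
Qed.

Lemma graph_iso_connected G H : graph_iso G H -> connected G -> connected H.
Proof.
case=> f [g fK gK] fm [[x0 _] cG]; split; first by exists (f x0).
move=> x y; have /connectP[p gp e] := cG (g x) (g y).
apply/connectP; exists (map f p); last by rewrite -[x]gK last_map -e gK.
by rewrite -[x]gK; apply: homo_path gp => u v; rewrite fm.
Qed.

Lemma connected_closed G (U : {set G}) s y : connected G -> s \in U ->
  (forall u v, u \in U -> adj u v -> v \in U) -> y \in U.
Proof.
move=> [_ /(_ s y)/connectP[p sp ->]] sU cl; elim: p s sU sp => //= v p IH s sU.
by case/andP=> sv; apply: IH; apply: cl sv.
Qed.

Lemma edge_adj G (A : subgraph G) x y : [set x; y] \in edges A -> adj x y.
Proof.
move=> xy; have /forall_inP/(_ _ xy)/exists_inP[u _ /exists_inP[v _]] := subgraphP A.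
by case/andP=> uv /eqP/set2_eq[[-> ->]|[-> ->]] //; rewrite adj_sym.
Qed.

(** Only images of edges of [H] become edges, so further edges of [G] between image vertices do no
    harm. *)
Lemma hom_subgraph G H (p : H -> G) :
  injective p -> {homo p : x y / adj x y} ->
  exists2 A : subgraph G, verts A = [set p x | x : H] &
    graph_iso H (graph_of_subgraph A).
Proof.
move=> pI ph.
pose E := [set [set p u.1; p u.2] | u : H * H & adj u.1 u.2].
have AP : subgraph_axiom ([set p x | x : H], E).
  apply/forall_inP => e /imsetP[[u v]]; rewrite inE /= => uv ->.
  apply/exists_inP; exists (p u); rewrite ?imset_f //.
  by apply/exists_inP; exists (p v); rewrite ?imset_f // ph /=.
pose A := Subgraph AP; exists A => //.
have pA x : p x \in verts A by rewrite imset_f.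
exists (fun x => Sub (p x) (pA x) : graph_of_subgraph A) => [|x y].
  apply: inj_card_bij => [x y /(congr1 val)/pI //|].
  by rewrite card_sig -[#|H|](card_imset _ pI) subset_leq_card //; apply/subsetP.
apply/imsetP/idP => [[[u v]]|xy]; last by exists (x, y); rewrite ?inE.
by rewrite inE /= => uv /set2_eq[[/pI-> /pI->]|[/pI-> /pI->]] //; rewrite adj_sym.
Qed.

Lemma path_graph_connected k : 0 < k -> connected (path_graph k).
Proof.
move=> k0; pose o : path_graph k := Ordinal k0.
have oc (x : path_graph k) : connect (@adj (path_graph k)) o x.
  case: x => m; elim: m => [|m IH] mk.
    by rewrite (_ : Ordinal mk = o) ?connect0 //; apply: val_inj.
  apply: connect_trans (IH (ltnW mk)) (connect1 _).
  by rewrite /= /path_adj /= eqxx.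
split=> [|x y]; first by exists o.
apply: connect_trans (oc y); rewrite (sym_connect_sym (@adj_sym _)); exact: oc.
Qed.

(** Otherwise nothing leads out of the vertices of [B] at positions up to that of [u]: only the
    missing edge could. *)
Lemma path_subgraph_adj k (B : subgraph (path_graph k))
    (u v : graph_of_subgraph B) :
  connected (graph_of_subgraph B) -> (val (val u)).+1 = val (val v) -> adj u v.
Proof.
move=> cB uv; apply: contraT => nuv.
suff : v \in [set w : graph_of_subgraph B | val (val w) <= val (val u)].
  by rewrite inE -uv ltnn.
apply: (@connected_closed (graph_of_subgraph B) _ u v cB); first by rewrite inE.
move=> w w'; rewrite !inE => wu ww'.
have /orP[/eqP e|/eqP e] := edge_adj ww'; last first.
  exact: leq_trans (leq_trans (leqnSn _) (eq_leq e)) wu.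
rewrite leqNgt; apply: contra nuv => uw'.
have key a b c d : a.+1 = b -> c.+1 = d -> c <= a -> a < d -> b = d /\ c = a by lia.
have [/val_inj/val_inj-> /val_inj/val_inj<- //] := key _ _ _ _ uv e wu uw'.
Qed.

Definition connected_in_path k G (A : subgraph G) :=
  exists2 B : subgraph (path_graph k), connected (graph_of_subgraph B) &
    graph_iso (graph_of_subgraph A) (graph_of_subgraph B).

Lemma card_verts k G (A : subgraph G) : connected_in_path k A -> #|verts A| <= k.
Proof.
case=> B _ [f fb _].
have := bij_eq_card fb; rewrite !card_sig => ->.
by apply: leq_trans (max_card _) _; rewrite card_ord.
Qed.

(** Pair the positions [2i], [2i + 1]. By [path_subgraph_adj] an independent set uses at most one of
    each pair, so halving positions is injective on it. *)
Lemma card_independent k G (A : subgraph G) (I : {set G}) :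
  connected_in_path k A -> I \subset verts A ->
  {in I &, forall x y, ~~ adj x y} -> #|I| <= uphalf k.
Proof.
case=> B cB [f fb fm] /subsetP IA ind.
pose I' := [set a : graph_of_subgraph A | val a \in I].
have <- : #|I'| = #|I|.
  rewrite -(card_imset _ val_inj); apply: eq_card => x.
  apply/imsetP/idP => [[a]|xI]; first by rewrite inE => ? ->.
  by exists (Sub x (IA x xI)); rewrite ?inE.
have hP (a : graph_of_subgraph A) : (val (val (f a)))./2 < uphalf k.
  by have := ltn_ord (val (f a)); rewrite /=; lia.
rewrite -[uphalf k]card_ord; pose h a := Ordinal (hP a).
rewrite -(card_in_imset (f := h)) ?max_card // => a b; rewrite !inE => aI bI.
move/(congr1 val) => /= ab; apply/(bij_inj fb)/val_inj/val_inj.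
have na : ~~ adj (f a) (f b).
  by rewrite fm; apply: contra (ind _ _ aI bI); apply: edge_adj.
have n1 : (val (val (f a))).+1 <> val (val (f b)).
  by move/(path_subgraph_adj cB); apply/negP.
have n2 : (val (val (f b))).+1 <> val (val (f a)).
  by move/(path_subgraph_adj cB); rewrite adj_sym; apply/negP.
have key c d : c.+1 <> d -> d.+1 <> c -> c./2 = d./2 -> c = d by lia.
exact: key n1 n2 ab.
Qed.

Lemma verts_sub_closed k G (A : subgraph G) (U : {set G}) s :
  connected_in_path k A -> s \in verts A -> s \in U ->
  (forall u v, u \in U -> v \in verts A -> adj u v -> v \in U) ->
  verts A \subset U.
Proof.
case=> B cB /graph_iso_sym/graph_iso_connected/(_ cB) cA sA sU cl.
apply/subsetP => y yA.
have : (Sub y yA : graph_of_subgraph A) \in [set a : graph_of_subgraph A | val a \in U].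
  apply: (@connected_closed (graph_of_subgraph A) _ (Sub s sA) _ cA); first by rewrite inE.
  by move=> u v; rewrite !inE => uU /edge_adj; apply: cl => //; apply: valP.
by rewrite inE.
Qed.

Lemma structure_substructure k G (F : {set subgraph G}) : 0 < k ->
  structure_cut (path_graph k) F -> substructure_cut (path_graph k) F.
Proof.
move=> k0 [Fk sF]; split=> // A /Fk Ak.
have [B _ kB] := @hom_subgraph (path_graph k) (path_graph k) id
  (fun _ _ => id) (fun _ _ => id).
exists B; first exact: graph_iso_connected kB (path_graph_connected k0).
exact: graph_iso_trans Ak kB.
Qed.

End Graphs.

(** * The lower bound *)

Lemma card_bigcup (I T : finType) (F : {set I}) (f : I -> {set T}) :
  #|\bigcup_(i in F) f i| <= \sum_(i in F) #|f i|.
Proof.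
apply: (big_ind2 (fun (X : {set T}) m => #|X| <= m)); rewrite ?cards0 //.
move=> X a Y b Xa Yb; apply: leq_trans (leq_card_setU _ _) _.
exact: leq_add.
Qed.

Lemma delete_connected n (S : {set n.-tuple bool})
    (x y : @delete (hypercube n) S) :
  connect (step S setT) (val x) (val y) -> connect (@adj _) x y.
Proof.
case/connectP=> p; elim: p x => [|z p IH] x /=.
  by move=> _ /val_inj->; apply: connect0.
case/andP=> /and3P[_ zS /exists_inP[i _ /eqP e]] zp yl.
apply: (@connect_trans _ _ (Sub z zS : @delete (hypercube n) S)).
  by apply/connect1/cube_adjP; exists i.
exact: IH.
Qed.

Lemma substructure_cut_lower n k (F : {set subgraph (hypercube n)}) :
    2 < n -> 2 < k -> substructure_cut (path_graph k) F ->
  n <= #|F| * uphalf k.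
Proof.
move=> n3 k3 [Fk sep]; rewrite leqNgt; apply/negP => lt.
have Fk2 : #|F| * k <= 2 * n - 2.
  have : #|F| * k <= #|F| * (2 * uphalf k) by rewrite leq_mul2l; apply/orP; right; lia.
  by rewrite mulnCA; move: (#|F| * uphalf k) lt => c; lia.
pose S : {set n.-tuple bool} := family_verts F.
have cA A : A \in F -> #|verts A| <= k by move/Fk/card_verts.
have sumF : \sum_(A in F) #|verts A| <= #|F| * k.
  by rewrite -sum_nat_const; apply: leq_sum.
have few : #|S| <= 2 * n - 2.
  exact: leq_trans (card_bigcup _ _) (leq_trans sumF Fk2).
have iso x : x \notin S -> nonisolated S setT x.
  move=> xS; apply: contraT => /exists_inPn h.
  have NS i : flip i x \in S by have := h i (in_setT i); rewrite negbK.
  (* The neighbours of an isolated [x] share a parity, so each member of [F] covers at most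
     [uphalf k] of them. *)
  pose N : {set hypercube n} := [set flip i x | i : 'I_n].
  have cN : #|N| = n by rewrite card_imset ?card_ord //; apply: flip_index_inj.
  suff : n <= #|F| * uphalf k by rewrite leqNgt lt.
  rewrite -{1}cN -sum_nat_const.
  have /subset_leq_card/leq_trans : N \subset \bigcup_(A in F) (N :&: verts A).
    apply/subsetP => y yN; have /bigcupP[A AF yA] : y \in S.
      by case/imsetP: yN => i _ ->; apply: NS.
    by apply/bigcupP; exists A => //; rewrite inE yN.
  apply; apply: leq_trans (card_bigcup _ _) _; apply: leq_sum => A AF.
  apply: (card_independent (Fk A AF)); first exact: subsetIr.
  move=> y z; rewrite !inE => /andP[/imsetP[i _ ->] _] /andP[/imsetP[j _ ->] _].
  apply/negP => /cube_adjP[l /(congr1 (@parity n))].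
  by rewrite !parity_flip; case: parity.
have conn x y : x \notin S -> y \notin S -> connect (step S setT) x y.
  move=> xS yS; have [small|large] := leqP #|S| (2 * n - 3).
    apply: no_isolated_connected; rewrite ?cube_setT ?in_setT ?cardsT ?card_ord ?setIT //.
      exact: ltnW.
    by move=> z _; apply: iso.
  apply: tight_connected => // U US /set0Pn[s sU] cl.
  have /bigcupP[A AF sA] := subsetP US _ sU.
  have AU : verts A \subset U.
    apply: (verts_sub_closed (Fk A AF) sA sU) => u v uU vA /cube_adjP[p vp].
    by rewrite vp; apply: cl => //; rewrite -vp; apply/bigcupP; exists A.
  apply: leq_trans k3 (leq_trans _ (subset_leq_card AU)).
  (* A member with fewer than [k] vertices would leave [#|S| <= 2n - 3]. *)
  rewrite leqNgt; apply/negP => Ak.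
  have : \sum_(B in F) #|verts B| < #|F| * k.
    rewrite -sum_nat_const (bigD1 A) //= [ltnRHS](bigD1 A) //= -addSn.
    by apply: leq_add => //; apply: leq_sum => B /andP[BF _]; apply: cA.
  move=> /(leq_ltn_trans (card_bigcup _ _))/(leq_ltn_trans large).
  by move: Fk2; move: (#|F| * k) => c; lia.
case: sep => [[x [y /negP]]|].
  by apply; apply/delete_connected/conn; [exact: (valP x)|exact: (valP y)].
rewrite /trivial card_sig => e.
have := cardsC S; rewrite card_tuple card_bool.
have -> : #|~: S| = 1 by rewrite -e; apply: eq_card => x; rewrite !inE.
by have := exp2_ge n3; move: few; move: (2 ^ n) #|S| => a b; clear -n3; lia.
Qed.

(** * The upper bound: paths through neighbours of the origin *)

Section Zigzag.
Variable n : nat.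
Implicit Types (x y u : n.-tuple bool) (i j a b : 'I_n) (c s D : seq 'I_n).

Definition origin : n.-tuple bool := [tuple false | _ < n].

Lemma tnth_origin i : tnth origin i = false.
Proof. by rewrite tnth_mktuple. Qed.

Lemma cube_adj_flip i x : cube_adj x (flip i x).
Proof. by apply/cube_adjP; exists i. Qed.

Fixpoint gray u c : seq (n.-tuple bool) :=
  if c is i :: c' then gray u c' ++ gray (flip i (last u (gray u c'))) c'
  else [:: u].

Lemma gray_head u c : gray u c = u :: behead (gray u c).
Proof. by elim: c u => //= i c IH u; rewrite {1 3}IH. Qed.

Lemma mem_last_gray u c : last u (gray u c) \in gray u c.
Proof. by rewrite gray_head /= mem_last. Qed.

Lemma size_gray u c : size (gray u c) = 2 ^ size c.
Proof. by elim: c u => //= i c IH u; rewrite size_cat !IH addnn -mul2n expnS. Qed.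

Lemma gray_path u c : path (@cube_adj n) u (behead (gray u c)).
Proof.
elim: c u => //= i c IH u; rewrite gray_head /= cat_path IH /=.
by rewrite [gray (flip _ _) c]gray_head /= cube_adj_flip IH.
Qed.

Lemma tnth_gray u c x i : x \in gray u c -> i \notin c -> tnth x i = tnth u i.
Proof.
elim: c u x => /= [|j c IH] u x; first by rewrite inE => /eqP->.
rewrite inE negb_or mem_cat => /orP[] xg /andP[/negPf ij ic]; first exact: IH xg ic.
by rewrite (IH _ _ xg ic) tnth_flip ij addbF (IH u) // mem_last_gray.
Qed.

Lemma gray_uniq u c : uniq c -> uniq (gray u c).
Proof.
elim: c u => //= i c IH u /andP[ic uc]; rewrite cat_uniq !IH // andbT /=.
apply/hasPn => x xg; apply/negP => /tnth_gray/(_ ic).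
rewrite (tnth_gray xg ic) tnth_flip eqxx addbT.
rewrite (tnth_gray (mem_last_gray u c) ic); by case: (tnth u i).
Qed.

(** The innermost direction of the recursion is flipped first. *)
Lemma take2_gray u c i : take 2 (gray u (rcons c i)) = [:: u; flip i u].
Proof.
elim: c => //= j c IH; rewrite takel_cat ?IH //.
by rewrite size_gray size_rcons -[2]expn1 leq_exp2l.
Qed.

(* The coordinates visited are a :: b :: c; the final Gray code starts by      *)
(* flipping the last element of D, which is the last but one coordinate when  *)
(* D ends with belast a (b :: c), so that it passes through the last e_i.     *)
Fixpoint zigzag D a b c : seq (n.-tuple bool) :=
  let x := flip a origin in
  if c is b' :: c' then x :: flip b x :: zigzag D b b' c' else x :: gray (flip b x) D.

Lemma zigzag_head D a b c :
  zigzag D a b c = flip a origin :: behead (zigzag D a b c).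
Proof. by case: c. Qed.

Lemma size_zigzag D a b c : 2 ^ size D <= size (zigzag D a b c).
Proof.
elim: c a b => /= [|b' c IH] a b; first by rewrite size_gray.
by apply: leq_trans (IH b b') _; rewrite ltnW.
Qed.

Lemma zigzag_sorted D a b c : sorted (@cube_adj n) (zigzag D a b c).
Proof.
elim: c a b => /= [|b' c IH] a b.
  by rewrite gray_head /= cube_adj_flip gray_path.
have := IH b b'; rewrite zigzag_head /= cube_adj_flip /= => ->; rewrite andbT.
have -> : flip b origin = flip a (flip b (flip a origin)) by rewrite flipC flipK.
exact: cube_adj_flip.
Qed.

(** Used against repetitions: an earlier vertex with last coordinate 0 uses a coordinate outside
    [a :: b :: c], so it cannot recur. *)
Lemma tnth_zigzag D a b c x : last b c \notin D -> uniq (a :: b :: c) ->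
  x \in zigzag D a b c ->
  tnth x (last b c) \/ forall i, i \notin a :: b :: c -> tnth x i = false.
Proof.
elim: c a b => [|b' c IH] a b zD /=.
  rewrite inE => /andP[ab _]; rewrite inE => /orP[/eqP->|xg]; [right|left].
    move=> i; rewrite !inE negb_or => /andP[/negPf ia _].
    by rewrite tnth_flip ia tnth_origin.
  rewrite (tnth_gray xg zD) !tnth_flip eqxx eq_sym tnth_origin.
  by rewrite [a == b](negPf ab).
move=> /andP[_ ubc]; rewrite !in_cons => /or3P[/eqP->|/eqP->|xz].
- right=> i; rewrite in_cons negb_or => /andP[/negPf ia _].
  by rewrite tnth_flip ia tnth_origin.
- right=> i; rewrite !in_cons !negb_or => /and3P[/negPf ia /negPf ib _].
  by rewrite !tnth_flip ia ib tnth_origin.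
have [xl|h] := IH b b' zD ubc xz; first by left.
by right=> i; rewrite in_cons negb_or => /andP[_]; apply: h.
Qed.

Lemma origin_notin_zigzag D a b c : last b c \notin D -> uniq (a :: b :: c) ->
  origin \notin zigzag D a b c.
Proof.
have ne x i : tnth x i -> origin != x.
  by move=> xi; apply: contraTneq xi => <-; rewrite tnth_origin.
elim: c a b => [|b' c IH] a b zD uab; rewrite /= ?in_cons !negb_or.
  move: uab; rewrite /= inE => /andP[/negPf ab _].
  rewrite (ne _ a) ?tnth_flip ?eqxx ?tnth_origin //=.
  apply: contraT; rewrite negbK => /tnth_gray/(_ zD).
  by rewrite /= !tnth_flip eqxx !tnth_origin eq_sym ab.
case/andP: uab => anb ubc.
rewrite IH // andbT (ne _ a) ?tnth_flip ?eqxx ?tnth_origin //=.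
apply: (ne _ a); rewrite !tnth_flip eqxx tnth_origin.
by move: anb; rewrite in_cons negb_or => /andP[/negPf->].
Qed.

Lemma zigzag_uniq D a b c :
  uniq D -> last b c \notin D -> uniq (a :: b :: c) -> uniq (zigzag D a b c).
Proof.
move=> uD; elim: c a b => [|b' c IH] a b zD uab.
  rewrite /= gray_uniq // andbT; move: uab; rewrite /= inE => /andP[/negPf ab _].
  apply/negP => /tnth_gray/(_ zD).
  by rewrite /= !tnth_flip eqxx tnth_origin eq_sym ab.
have [anb ubc] := andP uab; have [bnc _] := andP ubc.
have zbc : last b (b' :: c) \in b' :: c by rewrite /= mem_last.
have za : last b (b' :: c) == a = false.
  by apply: contraNF anb => /eqP <-; rewrite in_cons zbc orbT.
have zb : last b (b' :: c) == b = false.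
  by apply: contraNF bnc => /eqP <-.
have ab : a == b = false.
  by apply: contraNF anb => /eqP <-; rewrite in_cons eqxx.
have notin x : tnth x a -> tnth x (last b (b' :: c)) = false ->
    x \notin zigzag D b b' c.
  move=> xa xz; apply/negP => /(@tnth_zigzag D b b' c x zD ubc)[|/(_ a anb)]; last by rewrite xa.
  by move: xz => /= ->.
rewrite /= in_cons negb_or !notin ?IH ?andbT //; try by
  rewrite !tnth_flip ?za ?zb ?ab ?eqxx tnth_origin.
apply/eqP => /(congr1 (fun y => tnth y b)).
by rewrite !tnth_flip eqxx; case: (_ (+) _).
Qed.

(** The neighbour of rank [j] sits at position [2j], even the last one, reached by the first flip of
    the Gray code. The prefix [D0] absorbs the head that [belast] loses in the induction. *)
Lemma mem_take_zigzag D0 a b c k i :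
    i \in take (uphalf k) (a :: b :: c) ->
  flip i origin \in take k (zigzag (D0 ++ belast a (b :: c)) a b c).
Proof.
elim: c a b k D0 => [|b' c IH] a b [|[|k]] D0 //=.
- by rewrite ?take0 !in_cons in_nil orbF => /eqP->; rewrite eqxx.
- rewrite cats1 in_cons; case/orP => [/eqP->|]; first by rewrite in_cons eqxx.
  case: k => [|k] //=; rewrite in_cons => /orP[/eqP->|]; last by case: (uphalf k).
  have -> : flip b origin = flip a (flip b (flip a origin)) by rewrite flipC flipK.
  have := take2_gray (flip b (flip a origin)) D0 a.
  rewrite gray_head; case: (behead _) => //= y t [->].
  by rewrite !in_cons eqxx !orbT.
- by rewrite ?take0 !in_cons in_nil orbF => /eqP->; rewrite eqxx.
rewrite in_cons => /orP[/eqP->|ic]; first by rewrite in_cons eqxx.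
rewrite !in_cons -cat_rcons; apply/orP; right; apply/orP; right.
exact: IH.
Qed.

Lemma cover_path k s : 1 < n -> 0 < k -> k <= 2 ^ n.-1 -> uniq s -> size s = n ->
  exists A : subgraph (hypercube n),
    [/\ graph_iso (graph_of_subgraph A) (path_graph k), origin \notin verts A &
        forall i, i \in take (uphalf k) s -> flip i origin \in verts A].
Proof.
case: s => [|a [|b c]] n1 k0 kn us sn; try by rewrite -sn in n1.
pose D := belast a (b :: c).
have eD : a :: b :: c = rcons D (last b c) by rewrite -lastI.
have [zD uD] : last b c \notin D /\ uniq D.
  by move: us; rewrite eD rcons_uniq => /andP[].
pose W := zigzag D a b c.
have kW : k <= size W.
  by apply: leq_trans kn (leq_trans _ (size_zigzag _ _ _ _));
    rewrite size_belast -[size (b :: c)]/(size (a :: b :: c)).-1 sn.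
pose p (i : path_graph k) : hypercube n := nth origin W (i : 'I_k).
have pW (i : 'I_k) : i < size W := leq_trans (ltn_ord i) kW.
have pI : injective p.
  by move=> i j /eqP; rewrite nth_uniq ?pW ?zigzag_uniq // => /eqP/val_inj.
have ph : {homo p : i j / adj i j}.
  have step (i j : 'I_k) : i.+1 = j -> cube_adj (p i) (p j).
    move=> ij; have /(sortedP origin) := zigzag_sorted D a b c.
    by rewrite /p -ij; apply; rewrite ij pW.
  by move=> i j /orP[]/eqP; [|rewrite adj_sym]; apply: step.
have [A vA Ak] := hom_subgraph pI ph.
exists A; split; first exact: graph_iso_sym.
  rewrite vA; apply/imsetP => -[i _ e].
  by have := origin_notin_zigzag zD us; rewrite e mem_nth ?pW.
move=> i /(@mem_take_zigzag [::]); rewrite vA -/D -/W => /(nthP origin)[m].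
rewrite size_takel // => mk; rewrite nth_take // => <-.
by apply/imsetP; exists (Ordinal mk).
Qed.

Lemma structure_cut_upper k v : 1 < n -> 0 < k -> k <= 2 ^ n.-1 ->
  n <= v * uphalf k ->
  exists2 F : {set subgraph (hypercube n)}, structure_cut (path_graph k) F & #|F| <= v.
Proof.
move=> n1 k0 kn nv; set m := uphalf k in nv.
have m0 : 0 < m by rewrite /m; lia.
(* Path [j] serves the block of coordinates starting at [j * m]; rotating keeps all [n] coordinates
   in the list, as [cover_path] needs for its length. *)
have exA (j : 'I_v) : exists A : subgraph (hypercube n),
    [/\ graph_iso (graph_of_subgraph A) (path_graph k), origin \notin verts A &
        forall i, i \in take m (rot (j * m) (enum 'I_n)) -> flip i origin \in verts A].
  by apply: cover_path; rewrite // ?rot_uniq ?enum_uniq ?size_rot ?size_enum_ord.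
have {exA}[A AP] := fin_all_exists exA.
exists [set A j | j : 'I_v]; last first.
  by apply: leq_trans (leq_imset_card _ _) _; rewrite card_ord.
split=> [_ /imsetP[j _ ->]|]; first by case: (AP j).
set F := [set A j | j : 'I_v].
have oF : origin \notin family_verts F.
  by apply/bigcupP => -[_ /imsetP[j _ ->]]; case: (AP j) => _ /negPf->.
have nF i : flip i origin \in family_verts F.
  have jv : i %/ m < v by rewrite ltn_divLR //; apply: leq_trans nv.
  apply/bigcupP; exists (A (Ordinal jv)); first exact: imset_f.
  case: (AP (Ordinal jv)) => _ _; apply=> /=.
  have im := divn_eq i m; have rm := ltn_pmod i m0.
  have lt : i %% m < n - i %/ m * m by have := ltn_ord i; lia.
  apply/(nthP i); exists (i %% m).
    rewrite size_take_min size_rot size_enum_ord leq_min rm.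
    exact: leq_ltn_trans (leq_mod i m) (ltn_ord i).
  rewrite nth_take // /rot nth_cat size_drop size_enum_ord lt nth_drop -im.
  exact: nth_ord_enum.
pose o : delete (family_verts F) := Sub origin oF.
have [c1|c1] := eqVneq #|delete (family_verts F)| 1; [by right | left].
have [y yo] : exists y : delete (family_verts F), y != o.
  apply/existsP; apply: contraR c1 => /existsPn h.
  rewrite -(cards1 o) -[X in X == _]cardsT; apply/eqP/eq_card => y.
  by rewrite !inE; have := h y; rewrite negbK => ->.
exists o, y; apply/negP => /connectP[[|w t] /= ]; first by move=> _ e; rewrite e eqxx in yo.
case/andP => /cube_adjP[i e] _ _.
by have /negP := valP w; apply; have -> : val w = flip i origin by []; apply: nF.
Qed.

End Zigzag.

(** * The ceiling, and the two connectivities *)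

Section CeilDiv.
Import Order.TTheory GRing.Theory Num.Theory.

Lemma ceil_div_leq m d f : 0 < d -> (ceil_div m d <= f) = (m <= f * d).
Proof.
move=> d0; have q0 : (0 <= m%:R / d%:R :> rat)%R by rewrite divr_ge0 ?ler0n.
have c0 : (0 <= Num.ceil (m%:R / d%:R : rat))%R.
  by rewrite -(ler_int rat) (le_trans q0) ?ceil_ge.
rewrite /ceil_div -lez_nat gez0_abs // ceil_le_int ler_pdivrMr ?ltr0n //.
by rewrite pmulrn -natrM ler_nat.
Qed.

End CeilDiv.

Theorem theorem13 (n k : nat) (hn : 3 <= n) (hk3 : 3 <= k)
    (hk : k <= 2 ^ (n - 1)) :
  let v := if odd k then ceil_div (2 * n) (k + 1) else ceil_div (2 * n) k in
  substructure_connectivity (hypercube n) (path_graph k) v /\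
  structure_connectivity (hypercube n) (path_graph k) v.
Proof.
move=> v.
(* Describing [v] by its upper bounds merges the two parities of [k]. *)
have vP f : (v <= f) = (n <= f * uphalf k).
  rewrite /v; have := odd_double_half k; rewrite uphalf_half -muln2.
  by case: (odd k) => /= e; rewrite ceil_div_leq; nia.
have k0 : 0 < k by apply: leq_trans hk3.
have lower F : @substructure_cut (hypercube n) (path_graph k) F -> v <= #|F|.
  by move=> Fs; rewrite vP; apply: substructure_cut_lower.
have sub := @structure_substructure k (hypercube n) _ k0.
have nv : n <= v * uphalf k by rewrite -vP.
rewrite subn1 in hk.
have [F Fcut Fv] := structure_cut_upper (ltnW hn) k0 hk nv.
(* Different indices might have produced the same subgraph; the lower bound excludes a smaller
   family. *)
have eF : #|F| = v by apply/eqP; rewrite eqn_leq Fv lower //; apply: sub.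
split; split; try by exists F => //; apply: sub.
  exact: lower.
by move=> F' /sub; apply: lower.
Qed.
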